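(* Let $(\mathfrak{g},\bullet,\langle\;,\;\rangle)$ be a metrised symmetric Leibniz algebra obtained from the Lie algebra $(\mathfrak{g},[\;,\;])$ by means of $\omega$ such that $[\mathfrak{g},\mathfrak{g}]\neq\mathfrak{g}$. Let $Z(\mathfrak{g})$ be the center of $(\mathfrak{g},[\;,\;])$. Then the following assertions hold. 1. If $Z(\mathfrak{g})$ is nondegenerate then $\mathfrak{g}=[\mathfrak{g},\mathfrak{g}]\oplus Z(\mathfrak{g})$ and there exist a totally isotropic subspace $I\subset Z(\mathfrak{g})$ and a 3-linear form $T:Z(\mathfrak{g})\times Z(\mathfrak{g})\times Z(\mathfrak{g})\to\mathbb{R}$ such that $T(I^\perp\cap Z(\mathfrak{g}),\cdot,\cdot)=0$ and $$x\bullet y=\begin{cases}[x,y]&\text{if } x\in[\mathfrak{g},\mathfrak{g}]\text{ or } y\in[\mathfrak{g},\mathfrak{g}],\\ \omega(x,y)&\text{if } x,y\in Z(\mathfrak{g}),\end{cases}$$ where the restriction of $\omega$ to $Z(\mathfrak{g})$ is given by $\langle\omega(x,y),z\rangle=T(x,y,z)$ for $x,y,z\in Z(\mathfrak{g})$. 2. If $Z(\mathfrak{g})$ is degenerate then $(\mathfrak{g},[\;,\;],\langle\;,\;\rangle)=\delta_A(\mathfrak{h})=\mathbb{R}e\oplus\mathfrak{h}\oplus\mathbb{R}\bar e$ is the double extension of a quadratic Lie algebra $(\mathfrak{h},[\;,\;]_{\mathfrak{h}},\langle\;,\;\rangle_{\mathfrak{h}})$ by means of some $A$; and when $A$ is invertible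 or $(\mathfrak{h},[\;,\;]_{\mathfrak{h}},\langle\;,\;\rangle_{\mathfrak{h}})$ is Euclidean, $\omega$ satisfies $\omega(\mathfrak{h}\oplus\mathbb{R}e,\cdot)=0$ and $\omega(\bar e,\bar e)=\mu e$ with $\mu\in\mathbb{R}$.
   Context: Algebras are real and finite dimensional. A metric is a nondegenerate symmetric bilinear form (Euclidean if positive definite); a subspace $F$ is nondegenerate if $F\cap F^\perp=\{0\}$, degenerate otherwise, and totally isotropic if $F\subset F^\perp$. A symmetric Leibniz algebra is both left Leibniz ($u\bullet(v\bullet w)=(u\bullet v)\bullet w+v\bullet(u\bullet w)$) and right Leibniz ($(v\bullet w)\bullet u=(v\bullet u)\bullet w+v\bullet(w\bullet u)$). Every symmetric Leibniz product has the form $u\bullet v=[u,v]+\omega(u,v)$ with $[\;,\;]$ a Lie bracket and $\omega:\mathfrak{g}\times\mathfrak{g}\to Z(\mathfrak{g})$ symmetric bilinear with $\omega([x,y],z)=\omega(\omega(x,y),z)=0$; one says it is obtained from $(\mathfrak{g},[\;,\;])$ by means of $\omega$. Metrised means endowed with an associative metric: $\langle u\bullet v,w\rangle=\langle u,v\bullet w\rangle$; then $(\mathfrak{g},[\;,\;],\langle\;,\;\rangle)$ is a quadratic Lie algebra (a Lie algebra with a metric for which all $\mathrm{ad}_u$ are skew-symmetric). Double extension: let $(\mathfrak{h},[\;,\;]_{\mathfrak{h}},\langle\;,\;\rangle_{\mathfrak{h}})$ be a quadratic Lie algebra and $A$ a skew-symmetric derivation of it. $\delta_A(\mathfrak{h})=\mathbb{R}e\oplus\mathfrak{h}\oplus\mathbb{R}\bar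 e$ has the non-vanishing brackets and metric, for $u,v\in\mathfrak{h}$, $$[\bar e,u]=Au,\quad [u,v]=\langle Au,v\rangle_{\mathfrak{h}}e+[u,v]_{\mathfrak{h}},\quad \langle xe+u+\bar x\bar e,xe+u+\bar x\bar e\rangle=2x\bar x+\langle u,u\rangle_{\mathfrak{h}};$$ it is a quadratic Lie algebra. *)

(* Defs.v *)
From HB Require Import structures.
From mathcomp Require Import all_boot all_order all_algebra.
From mathcomp Require Import ring reals.

Set Implicit Arguments.
Unset Strict Implicit.
Unset Printing Implicit Defensive.

Import Order.TTheory GRing.Theory Num.Theory.

Local Open Scope ring_scope.

Section Subspaces.
Variables (R : realType) (V : vectType R).
Implicit Types (br : {bilinear V -> V -> V}) (m : {symmetric V}).
Implicit Types (F U : {vspace V}).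

(* A metric is an m : {symmetric V} such that [nondegenerate m] holds. *)

Definition nondegenerate_subspace m F : bool := (F :&: orthov m F == 0)%VS.

Definition totally_isotropic m F : bool := (F <= orthov m F)%VS.

Definition euclidean m : Prop := forall u, u != 0 -> 0 < m u u.

Definition center br : {vspace V} :=
  lker (linfun (fun x : V => linfun (br x) : 'Hom(V, V))).

Lemma centerP br x : reflect (forall y, br x y = 0) (x \in center br).
Proof.
have lin : linear (fun x : V => linfun (br x) : 'Hom(V, V)).
  move=> a u v; apply/lfunP => y.
  by rewrite add_lfunE scale_lfunE !lfunE /= linearPl.
pose ad := HB.pack_for {linear V -> 'Hom(V, V)}
  (fun x : V => linfun (br x) : 'Hom(V, V))
  (GRing.isLinear.Build _ _ _ _ _ lin).
rewrite memv_ker; change (reflect (forall y, br x y = 0) (linfun ad x == 0)).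
rewrite lfunE /=; apply: (iffP eqP) => [h y|h].
  by have /lfunP/(_ y) := h; rewrite lfunE /= zero_lfunE.
by apply/lfunP => y; rewrite lfunE /= zero_lfunE.
Qed.

Definition derived br : {vspace V} :=
  <<[seq br x y | x <- vbasis fullv, y <- vbasis fullv]>>%VS.

Lemma derivedP br U : reflect (forall x y, br x y \in U) (derived br <= U)%VS.
Proof.
apply: (iffP (span_subvP)) => [h x y|h _ /allpairsP[[x y] [_ _ ->]]]; last first.
  exact: h.
rewrite (coord_vbasis (memvf x)) (coord_vbasis (memvf y)).
rewrite linear_sumlz rpred_sum // => i _; rewrite linear_sumr rpred_sum // => j _.
rewrite linearZl_LR linearZr_LR !rpredZ //.
by apply: h; apply: allpairs_f; rewrite mem_nth ?size_tuple.
Qed.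

End Subspaces.

Section Algebras.
Variables (R : realType) (V : vectType R).
Implicit Types (p br om : {bilinear V -> V -> V}) (m : {symmetric V}).

Definition left_leibniz p : Prop :=
  forall u v w, p u (p v w) = p (p u v) w + p v (p u w).

Definition right_leibniz p : Prop :=
  forall u v w, p (p v w) u = p (p v u) w + p v (p w u).

Definition symmetric_leibniz p : Prop := left_leibniz p /\ right_leibniz p.

Definition associative_metric p m : Prop :=
  nondegenerate m /\ forall u v w, m (p u v) w = m u (p v w).

Definition lie_bracket br : Prop :=
  (forall x, br x x = 0) /\
  (forall x y z, br x (br y z) + br y (br z x) + br z (br x y) = 0).

Definition quadratic_lie br m : Prop :=
  [/\ lie_bracket br,
      nondegenerate m
    & forall u v w, m (br u v) w = - m v (br u w)].

Definition obtained_by_means_of p br om : Prop :=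
  [/\ forall x y, om x y \in center br,
      forall x y, om x y = om y x,
      forall x y z, om (br x y) z = 0,
      forall x y z, om (om x y) z = 0
    & forall u v, p u v = br u v + om u v].

Definition skew_derivation br m (A : 'End(V)) : Prop :=
  (forall u v, A (br u v) = br (A u) v + br u (A v)) /\
  (forall u v, m (A u) v = - m u (A v)).

End Algebras.

Definition trilinear_form (R : realType) (U : lmodType R)
    (T : U -> U -> U -> R) : Prop :=
  [/\ forall y z, scalar (fun x => T x y z),
      forall x z, scalar (fun y => T x y z)
    & forall x y, scalar (fun z => T x y z)].

(* The element x e + u + x' ebar is encoded as the triple (x, u, x'). *)
Definition dext (R : realType) (h : vectType R) : vectType R :=
  (R^o * h * R^o)%type.

Section DoubleExtension.
Variables (R : realType) (h : vectType R).
Variables (br : {bilinear h -> h -> h}) (m : {symmetric h}) (A : 'End(h)).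

Definition dext_e : dext h := (1, 0, 0).
Definition dext_ebar : dext h := (0, 0, 1).

Definition dext_bracket (a b : dext h) : dext h :=
  (m (A a.1.2) b.1.2,
   br a.1.2 b.1.2 + (a.2 : R) *: A b.1.2 - (b.2 : R) *: A a.1.2,
   0).

Let lin3 (c : R) (p q s t w z : h) :
  c *: p + q + (c *: s + t) - (c *: w + z) = c *: (p + s - w) + (q + t - z).
Proof.
by rewrite opprD (addrACA (c *: p)) (addrACA (c *: p + _)) -scalerDr -scalerBr.
Qed.

Lemma dext_bracket_bilinear :
  bilinear_for (GRing.Scale.Law.clone _ _ *:%R _)
    (GRing.Scale.Law.clone _ _ *:%R _) dext_bracket.
Proof.
split=> [[[b u'] b'] c [[x u] x'] [[y v] y']|[[b u'] b'] c [[x u] x'] [[y v] y']];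
  congr (_, _, _) => /=; rewrite ?scaler0 ?addr0 //.
- by rewrite linearP linearPl.
- by rewrite linearPl linearP /= scalerDl scalerDr -scalerA (scalerA (b' : R))
    (mulrC (b' : R) c) -scalerA lin3.
- by rewrite linearP.
- by rewrite linearPr linearP /= scalerDr scalerDl -scalerA (scalerA (b' : R))
    (mulrC (b' : R) c) -scalerA lin3.
Qed.

HB.instance Definition _ := bilinear_isBilinear.Build R (dext h) (dext h)
  (dext h) _ _ dext_bracket dext_bracket_bilinear.

(* Polar form of x e + u + x' ebar |-> 2 x x' + <u, u>. *)
Definition dext_metric (a b : dext h) : R :=
  (a.1.1 : R) * b.2 + a.2 * b.1.1 + m a.1.2 b.1.2.

Lemma dext_metricE (x x' : R) (u : h) :
  dext_metric (x, u, x') (x, u, x') = 2 * x * x' + m u u.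
Proof. by rewrite /dext_metric /= (mulrC x' x) -mulr2n mulr_natl mulrnAl. Qed.

Lemma dext_metric_bilinear :
  bilinear_for (GRing.Scale.Law.clone _ _ *%R _)
    (GRing.Scale.Law.clone _ _ (idfun \; *%R) _) dext_metric.
Proof.
split=> [[[b u'] b'] c [[x u] x'] [[y v] y']|[[b u'] b'] c [[x u] x'] [[y v] y']];
  rewrite /dext_metric /= ?linearPl ?linearPr /= /GRing.scale /=; ring.
Qed.

Lemma dext_metric_sym (a b : dext h) :
  dext_metric a b = (-1) ^+ false * idfun (dext_metric b a).
Proof.
by rewrite /dext_metric (hermC m) /= !mul1r addrC addrAC; ring.
Qed.

HB.instance Definition _ := bilinear_isBilinear.Build R (dext h) (dext h) R
  _ _ dext_metric dext_metric_bilinear.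
HB.instance Definition _ := isHermitianSesquilinear.Build R (dext h) false idfun
  dext_metric dext_metric_sym.

End DoubleExtension.

Arguments dext_e {R h}.
Arguments dext_ebar {R h}.

Section DoubleExtensionOf.
Variables (R : realType) (g : vectType R).
Variables (br : {bilinear g -> g -> g}) (m : {symmetric g}).

(* The identification g = R e (+) h (+) R ebar is carried by phi. *)
Definition double_extension_of (h : vectType R)
    (brh : {bilinear h -> h -> h}) (mh : {symmetric h}) (A : 'End(h))
    (phi : 'Hom(dext h, g)) : Prop :=
  [/\ quadratic_lie brh mh,
      skew_derivation brh mh A,
      bijective phi,
      forall a b, phi (dext_bracket brh mh A a b) = br (phi a) (phi b)
    & isometry m (dext_metric mh) phi].

End DoubleExtensionOf.

(* Main.v *)
Require Import Defs.
From HB Require Import structures.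
From mathcomp Require Import all_boot all_order all_algebra.
From mathcomp Require Import ring lra reals.

Set Implicit Arguments.
Unset Strict Implicit.
Unset Printing Implicit Defensive.

Import Order.TTheory GRing.Theory Num.Theory.

Local Open Scope ring_scope.

(** The engine is a symmetry count.  Write the trilinear form of the product as
    [<u * v, w> = <[u, v], w> + <omega(u, v), w>].  Associativity of the metric
    makes this sum invariant under cyclic permutations, and swapping [u] and [v]
    separates the two terms; hence both are cyclic on their own, i.e. the metric
    is associative for the bracket and for [omega] ([split_associative]).  For an
    associative metric the annihilator of a product is the orthogonal of the
    span of its values ([orthov_derived]).  Applied to the bracket this gives
    [Z = D^perp], where [Z] is the center and [D] the derived algebra; applied
    to [omega], it shows that the span [I] of the values of [omega] is totally
    isotropic, because [omega] kills its own values, and that [omega] vanishes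
    on [I^perp].

    If [Z] is nondegenerate, [D] meets [Z] trivially, and [D + Z] has zero
    orthogonal, so it is everything; [omega] kills [D], and the form
    [<omega(x, y), z>] on [Z] satisfies the requirement with the space [I]
    above.

    If [Z] is degenerate, choose a nonzero [e] in [Z] orthogonal to [Z], and an
    isotropic [f] with [<e, f> = 1].  The orthogonal [h] of the hyperbolic plane
    spanned by [e] and [f] carries the bracket and the metric of the whole
    algebra followed by the orthogonal projection; since [e] is central, this
    projection only loses multiples of [e], and [ad f] maps into [h].  So the
    algebra is the double extension of [h] by the restriction of [ad f]
    ([reduction_double_extension]).

    Finally, let a double extension [R e + h + R ebar] with degenerate [Z] be
    given.  A central isotropic vector orthogonal to [e] is some [x e + u] with
    [u] in [h], [A u = 0] and [<u, u> = 0], so it is a multiple of [e] as soon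
    as [A] is invertible or [h] is Euclidean ([central_isotropic_line]).  A
    nonzero vector of [Z] orthogonal to [Z] is of this kind, so [e] itself is
    orthogonal to [Z].  Then all values of [omega], which are central and
    isotropic, are of this kind too, so they lie in [R e].  Therefore
    [<omega(v, y), z> = <v, omega(y, z)>] is zero for [v] in [R e + h], which is
    orthogonal to [e]. *)

(** * Metrics *)

Section Metrics.
Variables (R : realType) (V : vectType R) (m : {symmetric V}).

Lemma metricC x y : m x y = m y x.
Proof. by rewrite hermC expr0 mul1r. Qed.

(** The orthogonal of [U] is cut out by the [\dim U] linear equations given by a
    basis of [U], so its codimension is at most [\dim U]. *)
Lemma leq_dim_orthov (U : {vspace V}) :
  (\dim {:V} <= \dim U + \dim (orthov m U))%N.
Proof.
pose pairings x : 'rV_(\dim U) := \row_i m x (vbasis U)`_i.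
have pairings_linear : linear pairings.
  by move=> a x y; apply/rowP => i; rewrite !mxE linearPl.
pose f := linfun (HB.pack_for {linear V -> 'rV[R]_(\dim U)} pairings
  (GRing.isLinear.Build _ _ _ _ _ pairings_linear)).
have ker_f : (lker f <= orthov m U)%VS.
  apply/subvP => x; rewrite memv_ker lfunE => /eqP /rowP fx0.
  apply/mem_orthovP => y yU; rewrite (coord_vbasis yU) linear_sumr big1 // => i _.
  by rewrite linearZr_LR /=; have := fx0 i; rewrite !mxE => ->; exact: mulr0.
rewrite -(limg_ker_dim f fullv) capfv addnC leq_add ?dimvS //.
by rewrite (leq_trans (dimvS (subvf _))) // dimvf dim_matrix mul1r.
Qed.

Lemma orthov_eq0_full (U : {vspace V}) : orthov m U = 0%VS -> U = fullv.
Proof.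
move=> U0; apply/eqP; rewrite -(geq_leqif (dimv_leqif_eq (subvf U))).
by rewrite (leq_trans (leq_dim_orthov U)) // U0 dimv0 addn0.
Qed.

Lemma degenerate_subspaceP (U : {vspace V}) : ~~ nondegenerate_subspace m U ->
  exists2 e, e != 0 & e \in U /\ e \in orthov m U.
Proof.
rewrite /nondegenerate_subspace -vpick0 => e0; exists (vpick (U :&: orthov m U)) => //.
by apply/andP; rewrite -memv_cap memv_pick.
Qed.

Hypothesis nondeg : nondegenerate m.

Lemma nondegenerate_eq0 x : (forall y, m x y = 0) -> x = 0.
Proof.
by move=> x0; apply/eqP; rewrite -memv0 -(eqP nondeg); apply/mem_orthovP.
Qed.

(** [e] and [f] span a hyperbolic plane, whose orthogonal is the space [h] of the
    double extension. *)
Lemma isotropic_partner e : e != 0 -> m e e = 0 ->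
  exists f, m e f = 1 /\ m f f = 0.
Proof.
move=> e0 ee; have : e \notin orthov m fullv by rewrite (eqP nondeg) memv0.
case/mem_orthovPn => v _ mve.
have [w ew] : exists w, m e w = 1.
  by exists ((m e v)^-1 *: v); rewrite linearZr_LR /= mulVf.
(* As e is isotropic and pairs to 1 with w, this multiple of e cancels the
   norm of w without changing the pairing. *)
exists (w - (m w w / 2) *: e).
rewrite !linearBr /= !linearBl /= !linearZr_LR !linearZl_LR /= ee (metricC w e) ew.
by split; [ring | field].
Qed.

End Metrics.

(** * Products with an associative metric *)

Section OrthogonalOfValues.
Variables (R : realType) (V : vectType R).
Variables (p : {bilinear V -> V -> V}) (m : {symmetric V}).
Hypothesis metrised : associative_metric p m.

(** [center p] is the left annihilator of [p]; as [<p x y, z> = <x, p y z>],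
    annihilating everything amounts to being orthogonal to every value of [p]. *)
Lemma orthov_derived : orthov m (derived p) = center p.
Proof.
have [nondeg assoc] := metrised.
apply/vspaceP => x; apply/idP/centerP => [xD y | xZ].
  apply: (nondegenerate_eq0 nondeg) => z; rewrite assoc.
  by move/mem_orthovP: xD; apply; move/derivedP: (subvv (derived p)); apply.
rewrite mem_orthov_sym; apply/derivedP => y z.
by rewrite mem_orthov1 metricC -assoc xZ linear0l.
Qed.

Lemma derived_orth_center : (derived p <= orthov m (center p))%VS.
Proof. by rewrite orthov_sym orthov_derived. Qed.

Lemma nondegenerate_center_directv :
  nondegenerate_subspace m (center p) -> directv (derived p + center p).
Proof.
move/eqP => Z0; apply/directv_addP/eqP; rewrite -subv0 -Z0 capvC.
by rewrite capvS ?derived_orth_center.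
Qed.

(** The orthogonal of [derived p + center p] is the intersection of [center p]
    with its own orthogonal. *)
Lemma nondegenerate_center_full :
  nondegenerate_subspace m (center p) -> (derived p + center p)%VS = fullv.
Proof.
move/eqP => Z0; apply: (@orthov_eq0_full _ _ m); apply/eqP.
by rewrite -subv0 -Z0 subv_cap -[X in (_ <= X)%VS && _]orthov_derived -orthovD.
Qed.

End OrthogonalOfValues.

Lemma bracketC (R : realType) (V : vectType R) (br : {bilinear V -> V -> V}) :
  lie_bracket br -> forall x y, br x y = - br y x.
Proof.
move=> [alt _] x y; apply/eqP; rewrite -addr_eq0.
by have := alt (x + y); rewrite linearDl /= !linearDr /= !alt add0r addr0 => ->.
Qed.

Section AssociativeForms.
Variables (R : realType) (V : vectType R).
Variables (p br om : {bilinear V -> V -> V}) (m : {symmetric V}).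
Hypotheses (metrised : associative_metric p m) (lie : lie_bracket br).
Hypothesis by_means : obtained_by_means_of p br om.

(** Among the instances of cyclic invariance for the six orders of [x], [y], [z],
    symmetry and antisymmetry in the first two arguments leave a linear system
    that separates the bracket from [om]. *)
Lemma split_associative x y z :
  m (br x y) z = m x (br y z) /\ m (om x y) z = m x (om y z).
Proof.
case: by_means metrised => _ omC _ _ pE [_ pA].
have cyc a b c : m (br a b) c + m (om a b) c = m a (br b c) + m a (om b c).
  by rewrite -linearDl -linearDr /= -!pE pA.
have := cyc x y z; have := cyc y x z; have := cyc x z y; have := cyc y z x.
have := cyc z x y; have := cyc z y x.
rewrite (bracketC lie y x) (bracketC lie z x) (bracketC lie z y).
rewrite (omC y x) (omC z x) (omC z y).
rewrite !linearNl !linearNr /=.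
rewrite !(metricC m x) !(metricC m y) !(metricC m z).
by split; lra.
Qed.

Lemma associative_bracket : associative_metric br m.
Proof. by split=> [|x y z]; [case: metrised | have [] := split_associative x y z]. Qed.

Lemma associative_omega : associative_metric om m.
Proof. by split=> [|x y z]; [case: metrised | have [] := split_associative x y z]. Qed.

End AssociativeForms.

(** * Splitting off a hyperbolic plane *)

Lemma dext_metric_e (R : realType) (h : vectType R) (mh : {symmetric h}) a :
  dext_metric mh a dext_e = a.2.
Proof. by rewrite /dext_metric /= mulr0 add0r mulr1 linear0r addr0. Qed.

Section HyperbolicPlane.
Variables (R : realType) (V : vectType R) (m : {symmetric V}) (e f : V).
Hypotheses (ee : m e e = 0) (ef : m e f = 1) (ff : m f f = 0).

Definition core : {vspace V} := (orthov m <[e]> :&: orthov m <[f]>)%VS.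
Local Notation H := (subvs_of core).

Lemma mem_core x : (x \in core) = (m x e == 0) && (m x f == 0).
Proof. by rewrite memv_cap !mem_orthov1. Qed.

(** The orthogonal projection onto [core], whose complement is the plane spanned
    by [e] and [f]. *)
Definition core_part x := x - m x f *: e - m x e *: f.

Lemma core_part_mem x : core_part x \in core.
Proof.
rewrite mem_core /core_part !linearBl /= !linearZl_LR /= ee ff (metricC m f e) ef.
by rewrite !mulr0 !mulr1 subr0 !subrr eqxx.
Qed.

Lemma core_part_is_linear : linear core_part.
Proof.
move=> a x y; rewrite /core_part !linearPl /= !scalerDl !scalerBr !scalerA.
by rewrite !opprD (addrACA (a *: x)) (addrACA (a *: x - _)).
Qed.

HB.instance Definition _ :=
  GRing.isLinear.Build R V V _ core_part core_part_is_linear.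

(** [vsproj core] projects along an arbitrary complement of [core]; it acts here
    on vectors of [core] only, where it is the inverse of [vsval]. *)
Definition core_proj : V -> H := vsproj core \o core_part.

HB.instance Definition _ := GRing.Linear.on core_proj.

Lemma val_core_proj x : vsval (core_proj x) = core_part x.
Proof. by rewrite vsprojK ?core_part_mem. Qed.

Lemma core_orth_e (u : H) : m (vsval u) e = 0.
Proof. by have := subvsP u; rewrite mem_core => /andP[/eqP]. Qed.

Lemma core_orth_f (u : H) : m (vsval u) f = 0.
Proof. by have := subvsP u; rewrite mem_core => /andP[_ /eqP]. Qed.

Definition core_metric (u v : H) : R := m (vsval u) (vsval v).

Lemma core_metric_bilinear :
  bilinear_for (GRing.Scale.Law.clone _ _ *%R _)
    (GRing.Scale.Law.clone _ _ (idfun \; *%R) _) core_metric.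
Proof.
by split=> [u a v w|u a v w]; rewrite /core_metric linearP ?linearPl ?linearPr.
Qed.

Lemma core_metric_sym (u v : H) :
  core_metric u v = (-1) ^+ false * idfun (core_metric v u).
Proof. exact: hermC. Qed.

HB.instance Definition _ := bilinear_isBilinear.Build R H H R _ _
  core_metric core_metric_bilinear.
HB.instance Definition _ := isHermitianSesquilinear.Build R H false idfun
  core_metric core_metric_sym.

Lemma core_metric_proj (u : H) x : core_metric u (core_proj x) = m (vsval u) x.
Proof.
rewrite /core_metric val_core_proj /core_part !linearBr /= !linearZr_LR /=.
by rewrite core_orth_e core_orth_f !mulr0 !subr0.
Qed.

Definition core_join (a : dext H) : V :=
  (a.1.1 : R) *: e + vsval a.1.2 + (a.2 : R) *: f.

Lemma core_join_is_linear : linear core_join.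
Proof.
move=> c [[x u] x'] [[y v] y']; rewrite /core_join /= !scalerDl !scalerDr !scalerA.
by rewrite (addrACA (_ *: e)) (addrACA (_ *: e + _)).
Qed.

HB.instance Definition _ :=
  GRing.isLinear.Build R (dext H) V _ core_join core_join_is_linear.

Definition core_split (x : V) : dext H := (m x f, core_proj x, m x e).

Lemma core_splitK : cancel core_split core_join.
Proof.
by move=> x; rewrite /core_join /= val_core_proj /core_part -addrA subrK addrC subrK.
Qed.

Lemma metric_core_join_e a : m (core_join a) e = a.2.
Proof.
rewrite /core_join !linearDl /= !linearZl_LR /= core_orth_e ee (metricC m f) ef.
by rewrite mulr0 mulr1 !add0r.
Qed.

Lemma metric_core_join_f a : m (core_join a) f = a.1.1.
Proof.
rewrite /core_join !linearDl /= !linearZl_LR /= core_orth_f ff ef.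
by rewrite mulr0 mulr1 !addr0.
Qed.

Lemma core_joinK : cancel core_join core_split.
Proof.
move=> a; rewrite /core_split metric_core_join_e metric_core_join_f.
rewrite [in RHS](surjective_pairing a) [in RHS](surjective_pairing a.1).
congr (_, _, _); apply: subvs_inj; rewrite val_core_proj /core_part.
rewrite metric_core_join_e metric_core_join_f /core_join.
by rewrite -[X in X - _ - _]addrA (addrC (_ *: e)) !addrK.
Qed.

Lemma core_join_isometry a b :
  m (core_join a) (core_join b) = dext_metric core_metric a b.
Proof.
rewrite {2}/core_join !linearDr /= !linearZr_LR /=.
rewrite metric_core_join_e metric_core_join_f /core_join !linearDl /= !linearZl_LR.
rewrite /= !(metricC m _ (vsval b.1.2)) core_orth_e core_orth_f !mulr0 addr0 add0r.
rewrite /dext_metric /= addrAC; congr (_ + _); last by rewrite metricC.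
by rewrite addrC mulrC (mulrC a.2).
Qed.

End HyperbolicPlane.

(** * The double extension given by a central isotropic vector *)

Section CentralIsotropicVector.
Variables (R : realType) (V : vectType R).
Variables (br : {bilinear V -> V -> V}) (m : {symmetric V}).
Hypotheses (lie : lie_bracket br) (metrised : associative_metric br m).

Let nondeg : nondegenerate m := metrised.1.
Let br_assoc : forall x y z, m (br x y) z = m x (br y z) := metrised.2.

Variables (e f : V).
Hypotheses (ee : m e e = 0) (ef : m e f = 1) (ff : m f f = 0).
Hypothesis eZ : e \in center br.

Local Notation H := (subvs_of (core m e f)).
Local Notation proj := (core_proj m e f).

Lemma bracket_orth_center z x y : z \in center br -> m (br x y) z = 0.
Proof.
by move=> /centerP zZ; rewrite br_assoc (bracketC lie) zZ oppr0 linear0r.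
Qed.

(** The projection removes a multiple of [e], which is central, and
    [m x e] times [f]. *)
Lemma bracket_proj x y : br (vsval (proj x)) y = br x y - m x e *: br f y.
Proof.
rewrite val_core_proj // /core_part !linearBl /= !linearZl_LR /=.
by move/centerP: eZ => ->; rewrite scaler0 subr0.
Qed.

(** Values of the bracket are orthogonal to the central vector [e], so they have no
    component along [f]; Jacobi therefore passes to [core]. *)
Lemma bracket_proj_bracket x y z : br z (vsval (proj (br x y))) = br z (br x y).
Proof.
rewrite !(bracketC lie z) bracket_proj (bracket_orth_center _ _ eZ).
by rewrite scale0r subr0.
Qed.

Lemma metric_adN x y z : m x (br y z) = - m z (br y x).
Proof. by rewrite -br_assoc (bracketC lie) linearNl (metricC m z). Qed.

Lemma val_proj_bracket x y : vsval (proj (br x y)) = br x y - m (br x y) f *: e.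
Proof.
by rewrite val_core_proj // /core_part (bracket_orth_center _ _ eZ) scale0r subr0.
Qed.

Lemma val_proj_ad x : vsval (proj (br f x)) = br f x.
Proof.
have [alt _] := lie.
by rewrite val_proj_bracket metricC metric_adN alt linear0r oppr0 scale0r subr0.
Qed.

Definition core_bracket (u v : H) : H := proj (br (vsval u) (vsval v)).

Lemma core_bracket_bilinear :
  bilinear_for (GRing.Scale.Law.clone _ _ *:%R _)
    (GRing.Scale.Law.clone _ _ *:%R _) core_bracket.
Proof.
split=> [u a v w|u a v w]; rewrite /core_bracket linearP.
  by rewrite linearPl linearP.
by rewrite !linearP.
Qed.

HB.instance Definition _ := bilinear_isBilinear.Build R H H H _ _
  core_bracket core_bracket_bilinear.

Local Notation brh := (core_bracket : {bilinear H -> H -> H}).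
Local Notation mh := (@core_metric R V m e f : {symmetric H}).

Lemma brhE u v : brh u v = proj (br (vsval u) (vsval v)).
Proof. by []. Qed.

Lemma mh_proj (u : H) x : mh u (proj x) = m (vsval u) x.
Proof. exact: core_metric_proj. Qed.

Lemma core_quadratic_lie : quadratic_lie brh mh.
Proof.
have [alt jacobi] := lie; split; first split.
- by move=> u; rewrite brhE alt linear0.
- move=> u v w; rewrite !brhE !bracket_proj_bracket -!linearD /=.
  by rewrite jacobi linear0.
- apply/eqP/vspaceP => u; rewrite memv0; apply/idP/eqP => [|->]; last exact: mem0v.
  move/mem_orthovP => u0; apply: subvs_inj; rewrite linear0.
  apply: (nondegenerate_eq0 nondeg) => x.
  by rewrite -mh_proj //; apply: u0; apply: memvf.
move=> u v w; rewrite (metricC mh) !brhE !mh_proj //.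
by rewrite metric_adN metricC.
Qed.

Definition core_derivation : 'End(H) := linfun (proj \o br f \o vsval).

Lemma core_derivationE u : core_derivation u = proj (br f (vsval u)).
Proof. by rewrite lfunE. Qed.

(** Since [ad f] maps into [core], no correction by [e] appears and the derivation
    rule is the Jacobi identity for [f], [u], [v]. *)
Lemma core_derivation_skew : skew_derivation brh mh core_derivation.
Proof.
have [_ jacobi] := lie; split=> u v; rewrite !core_derivationE.
  rewrite !brhE bracket_proj_bracket !val_proj_ad -linearD /=; congr proj.
  rewrite -[LHS]subr0 -(jacobi f (vsval u) (vsval v)) (bracketC lie (br f _)).
  rewrite (bracketC lie (vsval v) f) linearNr opprD opprB.
  by rewrite addrC addrAC subrK addrC.
by rewrite (metricC mh) !mh_proj metric_adN.
Qed.

(** The projection loses the component [<[u, v], f> e] of [[u, v]]; invariance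
    gives [<[u, v], f> = <[f, u], v>], the cocycle of the double extension. *)
Lemma core_join_bracket a b :
  core_join (dext_bracket brh mh core_derivation a b)
  = br (core_join a) (core_join b).
Proof.
case: a b => [[x u] x'] [[y v] y']; have [alt _] := lie.
move/centerP: (eZ) => er.
rewrite /core_join /dext_bracket /= scale0r addr0 !core_derivationE.
rewrite !val_proj_ad /core_bracket val_proj_bracket.
rewrite !linearDl /= !linearDr /= !linearZl_LR !linearZr_LR /= !er alt.
rewrite !(bracketC lie _ e) !er !oppr0 !scaler0 !add0r.
have -> : core_metric (proj (br f (vsval u))) v = m (br (vsval u) (vsval v)) f.
  rewrite -[LHS](metricC mh) mh_proj br_assoc (bracketC lie f) linearNr.
  by rewrite -metric_adN metricC.
rewrite addr0 !addrA (addrC (_ *: e)) addrK (bracketC lie (vsval u) f) scalerN.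
by rewrite addrAC.
Qed.

Lemma reduction_double_extension :
  exists phi : 'Hom(dext H, V),
    double_extension_of br m brh mh core_derivation phi.
Proof.
exists (linfun (@core_join R V m e f)); split.
- exact: core_quadratic_lie.
- exact: core_derivation_skew.
- exists (core_split m e f) => x; rewrite lfunE /=; first exact: core_joinK.
  exact: core_splitK.
- by move=> a b; rewrite !lfunE /=; exact: core_join_bracket.
- by move=> a b; rewrite !lfunE /=; exact: core_join_isometry.
Qed.

End CentralIsotropicVector.

(** * The form omega on a double extension *)

Section OmegaOnDoubleExtension.
Variables (R : realType) (V h : vectType R).
Variables (br om : {bilinear V -> V -> V}) (m : {symmetric V}).
Variables (brh : {bilinear h -> h -> h}) (mh : {symmetric h}) (A : 'End(h)).
Variable phi : 'Hom(dext h, V).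
Hypothesis dext_phi : double_extension_of br m brh mh A phi.
Hypothesis A_or_h : bijective A \/ euclidean mh.

Lemma dext_e_central : phi dext_e \in center br.
Proof.
case: dext_phi => _ _ [psi _ psiK] phi_br _; apply/centerP => y.
rewrite -(psiK y) -phi_br /dext_bracket /= !linear0 linear0l.
by rewrite linear0l scale0r !addr0 linear0.
Qed.

(** Orthogonality to [e] removes the [ebar] component.  What remains is [x e + u],
    of norm [<u, u>], which is sent to [- A u] by bracketing with [ebar]. *)
Lemma central_isotropic_line z :
  z \in center br -> m z z = 0 -> m z (phi dext_e) = 0 ->
  exists c : R, z = c *: phi dext_e.
Proof.
case: dext_phi => _ _ phi_bij phi_br phi_m.
case: phi_bij => psi phiK psiK; rewrite -(psiK z).
case: (psi z) => [[x u] x'] /centerP zZ; rewrite !phi_m => zz ze.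
have x'0 : x' = 0.
  exact: etrans (esym (dext_metric_e mh (x, u, x'))) ze.
have u0 : u = 0.
  case: A_or_h => [A_bij | h_pos].
    have := zZ (phi dext_ebar); rewrite -phi_br -[RHS](linear0 phi).
    move/(can_inj phiK) => -[_].
    rewrite /= linear0r linear0 scaler0 !add0r scale1r => /eqP.
    rewrite oppr_eq0 -[X in _ == X](linear0 A) => /eqP.
    exact: (bij_inj A_bij).
  apply/eqP; case: eqP => // /eqP /h_pos.
  have := etrans (esym (dext_metricE mh x x' u)) zz.
  by rewrite x'0 mulr0 add0r => ->; rewrite ltxx.
exists x; rewrite x'0 u0 -linearZ /=; congr (phi (_, _, _)).
- exact: esym (mulr1 _).
- by rewrite scaler0.
- by rewrite /= scaler0.
Qed.

Hypothesis om_central : forall x y, om x y \in center br.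
Hypothesis omC : forall x y, om x y = om y x.
Hypothesis om_om : forall x y z, om (om x y) z = 0.
Hypothesis om_metrised : associative_metric om m.

Let nondeg : nondegenerate m := om_metrised.1.
Let om_assoc : forall x y z, m (om x y) z = m x (om y z) := om_metrised.2.

Hypothesis Z_degenerate : ~~ nondegenerate_subspace m (center br).

(** Degeneracy provides a nonzero [w] in the center orthogonal to the center; it is
    proportional to [e], so [e] inherits this orthogonality. *)
Lemma center_orth_dext_e z : z \in center br -> m z (phi dext_e) = 0.
Proof.
move=> zZ; have eZ := dext_e_central.
have [w w0 [wZ /mem_orthovP wZo]] := degenerate_subspaceP Z_degenerate.
have [c wE] := central_isotropic_line wZ (wZo _ wZ) (wZo _ eZ).
have c0 : c != 0 by apply: contraNneq w0 => c0; rewrite wE c0 scale0r.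
have := wZo _ zZ; rewrite wE linearZl_LR /= => /eqP.
by rewrite mulf_eq0 (negPf c0) /= metricC => /eqP.
Qed.

(** [om x y] is isotropic: [<om x y, om x y> = <x, om y (om x y)> = 0]. *)
Lemma omega_line x y : exists c : R, om x y = c *: phi dext_e.
Proof.
apply: central_isotropic_line; rewrite ?center_orth_dext_e ?om_central //.
by rewrite om_assoc (omC y) om_om linear0r.
Qed.

Lemma omega_dext_ideal (x : R) (u : h) (y : V) :
  om (phi ((x, u, 0) : dext h)) y = 0.
Proof.
apply: (nondegenerate_eq0 nondeg) => z; rewrite om_assoc.
have [c ->] := omega_line y z; case: dext_phi => _ _ _ _ phi_m.
rewrite linearZr_LR /= phi_m.
by rewrite [X in _ * X](dext_metric_e mh (x, u, 0)) mulr0.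
Qed.

Lemma omega_dext_ebar :
  exists mu : R, om (phi dext_ebar) (phi dext_ebar) = mu *: phi dext_e.
Proof. exact: omega_line. Qed.

End OmegaOnDoubleExtension.

(** * Nondegenerate and degenerate centers *)

Theorem theorem3p3 (R : realType) (g : vectType R)
    (bullet bracket omega : {bilinear g -> g -> g}) (metric : {symmetric g})
    (leibniz : symmetric_leibniz bullet)
    (metrised : associative_metric bullet metric)
    (lie : lie_bracket bracket)
    (by_means : obtained_by_means_of bullet bracket omega)
    (not_perfect : derived bracket <> fullv) :
  let Z := center bracket in
  let D := derived bracket in
  (nondegenerate_subspace metric Z ->
    ((D + Z)%VS = fullv /\ directv (D + Z)) /\
    exists (I : {vspace g})
           (T : subvs_of Z -> subvs_of Z -> subvs_of Z -> R),
      [/\ (I <= Z)%VS,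
          totally_isotropic metric I,
          trilinear_form T,
          (forall x y z : subvs_of Z,
             vsval x \in orthov metric I -> T x y z = 0)
        & [/\ forall x y, x \in D \/ y \in D -> bullet x y = bracket x y,
              forall x y, x \in Z -> y \in Z -> bullet x y = omega x y
            & forall x y z : subvs_of Z,
                metric (omega (vsval x) (vsval y)) (vsval z) = T x y z]])
  /\
  (~~ nondegenerate_subspace metric Z ->
    (exists (h : vectType R) (brh : {bilinear h -> h -> h})
            (mh : {symmetric h}) (A : 'End(h)) (phi : 'Hom(dext h, g)),
       double_extension_of bracket metric brh mh A phi) /\
    (forall (h : vectType R) (brh : {bilinear h -> h -> h})
            (mh : {symmetric h}) (A : 'End(h)) (phi : 'Hom(dext h, g)),
       double_extension_of bracket metric brh mh A phi ->
       bijective A \/ euclidean mh ->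
       (forall (x : R) (u : h) (y : g),
          omega (phi ((x, u, 0) : dext h)) y = 0) /\
       exists mu : R, omega (phi dext_ebar) (phi dext_ebar) = mu *: phi dext_e)).
Proof.
move=> Z D; have br_metrised := associative_bracket metrised lie by_means.
have om_metrised := associative_omega metrised lie by_means.
case: by_means => om_central omC om_br om_om bulletE.
split=> [Z_nondeg | Z_deg].
  split.
    by split; [exact: nondegenerate_center_full br_metrised _
              | exact: nondegenerate_center_directv br_metrised _].
  exists (derived omega),
    (fun x y z => metric (omega (vsval x) (vsval y)) (vsval z)).
  have om_D x y : x \in D -> omega x y = 0.
    have /subvP D_om : (D <= center omega)%VS.
      by apply/derivedP => u v; apply/centerP.
    by move/D_om/centerP.
  split.
  - exact/derivedP.
  - rewrite /totally_isotropic (orthov_derived om_metrised).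
    by apply/derivedP => x y; apply/centerP.
  - by split=> [y z|x z|x y] a u v; rewrite linearP ?linearPl ?linearPr ?linearP.
  - move=> x y z; rewrite (orthov_derived om_metrised) => /centerP ->.
    by rewrite linear0l.
  - split=> [x y [xD|yD]|x y /centerP xZ _|//]; rewrite bulletE.
    + by rewrite om_D // addr0.
    + by rewrite omC om_D // addr0.
    + by rewrite xZ add0r.
split=> [|h brh mh A phi dext_phi A_or_h].
  have [e e0 [eZ /mem_orthovP eZo]] := degenerate_subspaceP Z_deg.
  have [f [ef ff]] := isotropic_partner metrised.1 e0 (eZo _ eZ).
  have [phi dext_phi] :=
    reduction_double_extension lie br_metrised (eZo _ eZ) ef ff eZ.
  by do 5 eexists; exact: dext_phi.
split.
  exact: omega_dext_ideal dext_phi A_or_h om_central omC om_om om_metrised Z_deg.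
exact: omega_dext_ebar dext_phi A_or_h om_central omC om_om om_metrised Z_deg.
Qed.
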